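(* For every fixed integer $r\ge 1$, $$A_r(n)\sim C_r\,n\log\log n\qquad (n\to\infty),$$ i.e. $\lim_{n\to\infty} A_r(n)/(n\log\log n)=C_r$.
   Context: For a partition $\mu=(\mu_1,\ldots,\mu_i)$ write $|\mu|=\mu_1+\cdots+\mu_i$ for its size and $\ell(\mu)=i$ for its number of (positive) parts; $\mu\vdash j$ means $|\mu|=j$. $m_\mu(x_1,\ldots,x_n)$ is the monomial symmetric polynomial: the sum of all distinct monomials obtained by assigning the positive exponents $\mu_1,\ldots,\mu_i$ to distinct variables among $x_1,\ldots,x_n$ (it is $0$ if $i>n$). For $n\ge1$ define $$E_{i,j}(n)=\sum_{\mu\vdash j,\ \ell(\mu)=i}\frac{m_\mu(1,1/2,\ldots,1/n)}{\mu_1!\cdots\mu_i!},\qquad E_{0,0}(n)=1,$$ (empty sums are $0$), and for $r\ge1$ $$A_r(n)=\sum_{i=1}^{n}\log(i+r)\,E_{i,i+r-1}(n).$$ Let $$\mathcal H(u)=\prod_{q=1}^\infty\frac{q}{q+1}\left(1+\frac{e^{u/q}-1}{u}\right),$$ where $(e^{u/q}-1)/u$ is given its removable value $1/q$ at $u=0$; this product converges locally uniformly near $u=0$. Define $C_r=[u^{r-1}]\mathcal H(u)$, the coefficient of $u^{r-1}$ in the Taylor expansion of $\mathcal H$ at $0$. *)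

(* Defs.v *)
From HB Require Import structures.
From mathcomp Require Import all_boot all_order all_algebra.
From mathcomp Require Import all_classical all_reals all_analysis.
Set Implicit Arguments.
Unset Strict Implicit.
Unset Printing Implicit Defensive.
Import Order.TTheory GRing.Theory Num.Theory.
Import numFieldNormedType.Exports.
Local Open Scope classical_set_scope.
Local Open Scope ring_scope.

Definition is_partition (j : nat) (mu : seq nat) : bool :=
  [&& sorted geq mu, all (leq 1) mu & sumn mu == j].

(** The value at [x] of the monomial symmetric polynomial of [mu].  Distinct
    monomials correspond to distinct exponent vectors [a], and [a] occurs when
    its positive entries are, up to order, the parts of [mu].  Such entries are
    at most [sumn mu], so bounding the exponents loses nothing. *)
Definition monomial_sym (R : comNzRingType) (n : nat) (mu : seq nat)
    (x : 'I_n -> R) : R :=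
  \sum_(a : {ffun 'I_n -> 'I_(sumn mu).+1}
        | perm_eq [seq val p | p <- codom a & (0 < val p)%N] mu)
    \prod_(k < n) x k ^+ a k.

(** Partitions of [j] with [i] parts are enumerated as [i]-tuples with entries
    at most [j].  For [i = j = 0] the only term is the empty partition, whose
    monomial symmetric polynomial is 1. *)
Definition Ecoef (R : realType) (i j n : nat) : R :=
  \sum_(mu : i.-tuple 'I_j.+1 | is_partition j (map val mu))
    monomial_sym (map val mu) (fun k : 'I_n => k.+1%:R^-1)
    / \prod_(p <- mu) (val p)`!%:R.

Definition Asum (R : realType) (r n : nat) : R :=
  \sum_(1 <= i < n.+1) ln (i + r)%:R * Ecoef R i (i + r - 1) n.

Definition Hfactor (R : realType) (q : nat) (u : R) : R :=
  q%:R / q.+1%:R *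
  (1 + (if u == 0 then q%:R^-1 else (expR (u / q%:R) - 1) / u)).

(** All Taylor coefficients of the entire function H are real, so H is only
    needed at real arguments. *)
Definition Hprod (R : realType) (u : R) : R :=
  lim ((fun N : nat => \prod_(1 <= q < N.+1) Hfactor q u) @ \oo).

Definition taylor_coef (R : realType) (f : R -> R) (a : R) (k : nat) : R :=
  derive1n k f a / k`!%:R.

Definition Ccoef (R : realType) (r : nat) : R :=
  taylor_coef (@Hprod R) 0 (r - 1).

Lemma Ecoef00 (R : realType) (n : nat) : Ecoef R 0 0 n = 1.
Proof.
rewrite /Ecoef (big_pred1 [tuple]); last first.
  by move=> mu; rewrite (tuple0 mu) /=; apply/esym/eqP/val_inj.
rewrite /= big_nil divr1 /monomial_sym (big_pred1 [ffun=> ord0]); last first.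
  move=> a /=; apply/idP/eqP => [_|_].
    by apply/ffunP => k; rewrite ffunE; apply/val_inj; case: (a k) => -[].
  rewrite (_ : [seq _ | _ <- _ & _] = [::]) //.
  by elim: (codom a) => //= -[[]//] ? s.
by rewrite big1// => k _; rewrite ffunE expr0.
Qed.

(* Main.v *)
Require Import Defs.
From HB Require Import structures.
From mathcomp Require Import all_boot all_order all_algebra.
From mathcomp Require Import all_classical all_reals all_analysis.
From mathcomp Require Import ring lra zify.
Set Implicit Arguments.
Unset Strict Implicit.
Unset Printing Implicit Defensive.
Import Order.TTheory GRing.Theory Num.Theory.
Import numFieldNormedType.Exports.
Local Open Scope classical_set_scope.
Local Open Scope ring_scope.

(** Put [s = r - 1].  The product
[\prod_(q <= n) (1 + z (e^(u/q) - 1) / u)] has [E_{i,i+s}(n)] as its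
coefficient of [z^i u^s]: expanding the product picks an exponent vector, [i]
counts its nonzero entries, and [s], the excess, is the sum of [a - 1] over the
nonzero entries [a].  Setting [z = 1] and dividing by [n + 1] gives the [n]-th partial
product of [H], so the normalised total mass
[M_s(n) = \sum_i E_{i,i+s}(n) / (n + 1)] is the Taylor coefficient of order
[s] of that partial product, and [M_s(n)] tends to [C_r].  It remains to see
that, under the weights [E_{i,i+s}(n)], the index [i] is close to [log n], so
that [log (i + r)] may be replaced by [log log n].

Everything is driven by one recursion in [n] ([wavg_rec_shift]): passing from
[n] to [n + 1] lets [i] jump by one with probability [1 / (n + 2)], up to terms
of lower excess whose coefficients sum to at most [1 / (n + 1)^2].

- Applied to the constant function, it shows that [M_s(n)] is nondecreasing in
  [n] and bounded by [5] uniformly in [s] and [n].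
- Applied to [(i - h_n)^2], with [h_n = 1/2 + ... + 1/(n+1)] the sum of the jump
  probabilities, it shows that this second moment is [O(h_n)] ([wvar_bound]),
  while [h_n = log n + O(1)].  Since
  [|log t - log L| <= 2 log L |t - L| / L] for [t >= 1] and [log L >= 1], the
  second moment controls the average of [log (i + r)] ([wavg_ln_cvg]).

For the identification of [lim M_s(n)] with a Taylor coefficient of [H], the
same recursion gives
[|H_n(u) - \sum_(s < S) M_s(n) u^s| <= 5 |u|^S] on [|u| <= 1], uniformly in [n]
and [S] ([Hprod_partial_approx]).  Letting [n] and then [S] tend to infinity shows
that [H] is, on [|u| < 1], the power series with coefficients [lim M_s(n)], which
is then differentiated term by term ([taylor_coef_pseries]). *)

(** * Exponent vectors counted by support and excess *)

(** The coefficient of [u^k] in [(e^(u/q) - 1) / u]. *)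
Definition expm1_coef (R : realType) (q k : nat) : R :=
  (q%:R ^+ k.+1 * k.+1`!%:R)^-1.

Lemma expm1_coef_ge0 (R : realType) q k : 0 <= expm1_coef R q k.
Proof. by rewrite invr_ge0 mulr_ge0// exprn_ge0. Qed.

(** The coefficient of [z^i u^s] in
    [\prod_(q <= n) (1 + z (e^(u/q) - 1) / u)], by recursion on the number of
    factors; [Ecoef_excess_weight] identifies it with [Ecoef R i (i + s) n]. *)
Fixpoint excess_weight (R : realType) (n i s : nat) : R :=
  if n is n'.+1 then
    excess_weight R n' i s +
    (if i is i'.+1 then
       \sum_(k < s.+1) expm1_coef R n k * excess_weight R n' i' (s - k)
     else 0)
  else ((i == 0) && (s == 0))%:R.

Lemma excess_weight_ge0 (R : realType) n i s : 0 <= excess_weight R n i s.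
Proof.
elim: n i s => [|n IH] i s /=; first by case: (_ && _).
rewrite addr_ge0//; case: i => // i; apply: sumr_ge0 => k _.
by rewrite mulr_ge0// expm1_coef_ge0.
Qed.

Lemma excess_weightS (R : realType) n i s :
  excess_weight R n.+1 i s = excess_weight R n i s +
    (if i is i'.+1 then
       \sum_(k < s.+1) expm1_coef R n.+1 k * excess_weight R n i' (s - k)
     else 0).
Proof. by []. Qed.

Lemma excess_weight_gt (R : realType) n i s : (n < i)%N -> excess_weight R n i s = 0.
Proof.
elim: n i s => [|n IH] [|i] s //= ni.
rewrite IH ?add0r; last exact: ltnW.
by apply: big1 => k _; rewrite IH ?mulr0.
Qed.

Definition exp_term (R : realType) (k e : nat) : R := k.+1%:R^-1 ^+ e / e`!%:R.

(** The multiset of positive entries of an exponent vector, in the form in which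
    [monomial_sym] compares it with a partition. *)
Definition pos_values n J (a : {ffun 'I_n -> 'I_J.+1}) : seq nat :=
  [seq val p | p <- codom a & (0 < val p)%N].

Lemma size_pos_values n J (a : {ffun 'I_n -> 'I_J.+1}) :
  size (pos_values a) = (\sum_(k < n) (0 < a k))%N.
Proof.
rewrite /pos_values size_map size_filter -sum1_count codomE big_map big_mkcond big_enum.
by apply: eq_bigr => k _ /=; case: (0 < a k)%N.
Qed.

Lemma sumn_pos_values n J (a : {ffun 'I_n -> 'I_J.+1}) :
  sumn (pos_values a) = (\sum_(k < n) a k)%N.
Proof.
rewrite /pos_values sumnE big_map big_filter codomE big_map big_mkcond big_enum /=.
by apply: eq_bigr => k _; case: (val (a k)).
Qed.

Lemma prod_fact_pos_values (R : realType) n J (a : {ffun 'I_n -> 'I_J.+1}) :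
  \prod_(p <- pos_values a) p`!%:R = \prod_(k < n) (a k)`!%:R :> R.
Proof.
rewrite /pos_values big_map big_filter codomE big_map big_mkcond big_enum /=.
by apply: eq_bigr => k _; case: (val (a k)).
Qed.

(** The exponent bound of [monomial_sym] mentions [mu]; replacing it by a fixed
    [j] lets the sums over partitions and over exponent vectors be exchanged. *)
Lemma monomial_symE (R : comNzRingType) n (mu : seq nat) (x : 'I_n -> R) j :
  sumn mu = j ->
  monomial_sym mu x =
  \sum_(a : {ffun 'I_n -> 'I_j.+1} | perm_eq (pos_values a) mu)
     \prod_(k < n) x k ^+ a k.
Proof. by move=> <-. Qed.

Lemma geq_total : total geq. Proof. by move=> m n; exact: leq_total. Qed.

Lemma geq_trans : transitive geq.
Proof. by move=> n m p mn np; exact: leq_trans np mn. Qed.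

Lemma geq_anti : antisymmetric geq.
Proof. by move=> m n; rewrite /geq /= andbC => /anti_leq. Qed.

(** Sorting is the only way to turn a multiset of positive integers into a
    partition, so at most one partition contributes to the sum. *)
Lemma sum_partition_perm (V : nmodType) i j (t : seq nat) (g : V) :
  all (leq 1) t ->
  \sum_(mu : i.-tuple 'I_j.+1 | is_partition j (map val mu) && perm_eq t (map val mu)) g
  = if (size t == i) && (sumn t == j) then g else 0.
Proof.
move=> t1; case: ifPn => [/andP[/eqP ti /eqP tj]|/negP ne]; last first.
  apply: big_pred0 => mu; apply/negP => /andP[/and3P[_ _ sj] pt]; apply: ne.
  by rewrite (perm_size pt) (perm_sumn pt) sj size_map size_tuple eqxx.
have tle p : p \in t -> (p < j.+1)%N.
  by move=> pt; rewrite ltnS -tj sumnE (perm_big _ (perm_to_rem pt)) big_cons leq_addr.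
(* The unique candidate is the decreasingly sorted sequence. *)
pose st := sort geq t.
have sti : size (map (inord : nat -> 'I_j.+1) st) == i.
  by rewrite size_map size_sort ti.
have valst : map val (map (inord : nat -> 'I_j.+1) st) = st.
  rewrite -map_comp -[RHS]map_id; apply/eq_in_map => p; rewrite mem_sort => pt /=.
  by rewrite inordK// tle.
rewrite (big_pred1 (Tuple sti))// => mu /=; apply/andP/eqP => [[/and3P[srt _ _] pt]|->].
  apply/val_inj/(inj_map val_inj) => /=; rewrite valst.
  apply: (sorted_eq geq_trans geq_anti) => //; first exact: sort_sorted geq_total _.
  by rewrite perm_sym (permPl (permEl (perm_sort _ _))).
rewrite valst /is_partition (sort_sorted geq_total).
rewrite (perm_all _ (permEl (perm_sort _ _))) t1.
rewrite (perm_sumn (permEl (perm_sort _ _))) tj eqxx.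
by rewrite perm_sym (permPl (permEl (perm_sort _ _))).
Qed.

(** An exponent vector determines its partition, and the product of the
    factorials of the parts is the product of those of all entries since
    [0! = 1].  Hence the sum over partitions becomes a sum over exponent vectors
    whose weight is a product over the variables. *)
Lemma EcoefE (R : realType) i j n :
  Ecoef R i j n =
  \sum_(a : {ffun 'I_n -> 'I_j.+1}
        | (\sum_(k < n) (0 < a k) == i)%N && (\sum_(k < n) a k == j)%N)
     \prod_(k < n) exp_term R k (a k).
Proof.
rewrite /Ecoef.
transitivity (\sum_(mu : i.-tuple 'I_j.+1 | is_partition j (map val mu))
  \sum_(a : {ffun 'I_n -> 'I_j.+1} | perm_eq (pos_values a) (map val mu))
     \prod_(k < n) exp_term R k (a k)).
  apply: eq_bigr => mu /and3P[_ _ /eqP smu].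
  rewrite (monomial_symE _ smu) mulr_suml; apply: eq_bigr => a pa.
  rewrite -(big_map val xpredT (fun p => p`!%:R)) -(perm_big _ pa) prod_fact_pos_values.
  by rewrite -prodf_div.
rewrite (exchange_big_dep xpredT)//= [RHS]big_mkcond; apply: eq_bigr => a _.
rewrite sum_partition_perm ?size_pos_values ?sumn_pos_values//.
by apply/allP => p /mapP[q]; rewrite mem_filter => /andP[q0 _] ->.
Qed.

(** The outer variable [z] marks a nonzero exponent [e] and the inner variable [u]
    carries its excess [e - 1]. *)
Definition gen_term (R : realType) (k e : nat) : {poly {poly R}} :=
  (exp_term R k e)%:P%:P * 'X^(0 < e)%N * ('X^(e.-1))%:P.

Definition gen_poly (R : realType) (J n : nat) : {poly {poly R}} :=
  \prod_(k < n) \sum_(e < J.+1) gen_term R k e.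

Lemma gen_poly_coef (R : realType) J n i s :
  (gen_poly R J n)`_i`_s =
  \sum_(a : {ffun 'I_n -> 'I_J.+1}
        | (\sum_(k < n) (0 < a k) == i)%N && (\sum_(k < n) (a k).-1 == s)%N)
     \prod_(k < n) exp_term R k (a k).
Proof.
rewrite /gen_poly (bigA_distr_bigA (fun (k : 'I_n) (e : 'I_J.+1) => gen_term R k e)).
rewrite !coef_sum [RHS]big_mkcond; apply: eq_bigr => a _.
set c := \prod_(k < n) _; rewrite /gen_term 2!big_split /=.
rewrite -!rmorph_prod /= -/c -!expr_sum.
rewrite -mulrA coefCM coefMC coefXn coefCM.
rewrite eq_sym; case: eqP => _ /=; last by rewrite mul0r coef0 mulr0.
rewrite mul1r coefXn eq_sym; by case: eqP => _; rewrite ?mulr1 ?mulr0.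
Qed.

(** Peeling off the last factor turns the product into the recursion of
    [excess_weight].  Truncating the exponents at [J] is harmless as soon as an
    excess equal to [s] can be produced by a single exponent, that is [s < J];
    with no nonzero exponent at all there is nothing to truncate. *)
Lemma gen_poly_excess_weight (R : realType) J n i s :
  (0 < i -> s < J)%N -> (gen_poly R J n)`_i`_s = excess_weight R n i s.
Proof.
elim: n i s => [|n IH] i s sJ.
  by rewrite /gen_poly big_ord0 coef1 /=; case: (i == 0%N);
    rewrite ?mulr1n ?coef1 ?coef0.
rewrite /gen_poly big_ord_recr -/(gen_poly R J n) big_ord_recl /=.
have -> : gen_term R n 0 = 1.
  by rewrite /gen_term /exp_term !expr0 divr1 !mulr1.
rewrite mulrDr mulr1 2!coefD (IH _ _ sJ); congr (_ + _).
rewrite mulr_sumr !coef_sum.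
have termE e : ((gen_poly R J n * gen_term R n e.+1)`_i)`_s =
   if i is i'.+1 then
     if (s < e)%N then 0 else expm1_coef R n.+1 e * (gen_poly R J n)`_i'`_(s - e)
   else 0.
  rewrite /gen_term expr1 mulrAC mulrA coefMX.
  case: i {sJ} => [|i] /=; first by rewrite coef0.
  rewrite -rmorphM /= coefMC mulrA mulrAC coefMC coefMXn mulrC.
  by case: ifP => // _; rewrite ?mulr0 // /exp_term /expm1_coef exprVn invfM.
under eq_bigr => e _ do rewrite termE.
case: i sJ {termE} => [|i] sJ; first by rewrite big1.
rewrite (big_ord_widen J
  (fun e => expm1_coef R n.+1 e * excess_weight R n i (s - e)) (sJ isT)).
rewrite [RHS]big_mkcond; apply: eq_bigr => e _ /=; rewrite ltnS.
case: ltnP => //= _; rewrite IH// => _; apply: leq_ltn_trans (leq_subr _ _) (sJ isT).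
Qed.

Lemma Ecoef_excess_weight (R : realType) i s n :
  Ecoef R i (i + s) n = excess_weight R n i s.
Proof.
rewrite EcoefE -(@gen_poly_excess_weight _ (i + s)) ?gen_poly_coef; last first.
  by move=> i0; rewrite -[X in (X < _)%N]add0n ltn_add2r.
apply: eq_bigl => a; case: eqP => //= supp.
have -> : (\sum_(k < n) a k = \sum_(k < n) (0 < a k) + \sum_(k < n) (a k).-1)%N.
  by rewrite -big_split; apply: eq_bigr => k _ /=; case: (val (a k)).
by rewrite supp eqn_add2l.
Qed.

(** * Coefficients of the factors of the product H *)

(** The coefficient of [u^k] in [Hfactor q u].  The normalisation [q / (q + 1)]
    makes the constant coefficient [1] for [q > 0]. *)
Definition Hfactor_coef (R : realType) (q k : nat) : R :=
  q%:R / q.+1%:R * ((k == 0)%:R + expm1_coef R q k).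

Lemma Hfactor_coef_ge0 (R : realType) q k : 0 <= Hfactor_coef R q k.
Proof. by rewrite !mulr_ge0// addr_ge0// expm1_coef_ge0. Qed.

Lemma Hfactor_coef0 (R : realType) n : Hfactor_coef R n.+1 0 = 1.
Proof.
rewrite /Hfactor_coef /expm1_coef eqxx expr1 mulr1 -[n.+2%:R]nat1r.
have : 0 < n.+1%:R :> R by rewrite ltr0n.
rewrite mulr1n.
by move: (n.+1%:R : R) => x x0; field; rewrite !lt0r_neq0 ?addr_gt0.
Qed.

Lemma expn2_le_fact k : (2 ^ k <= k.+1`!)%N.
Proof. by elim: k => // k IH; rewrite expnS factS leq_mul. Qed.

(** The coefficient carries at least two factors [1 / (n + 1)], and a factorial
    which dominates a power of two.  The former make the perturbation summable in
    [n], the latter makes it summable in [k]. *)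
Lemma Hfactor_coefS_le (R : realType) n k :
  Hfactor_coef R n.+1 k.+1 <= n.+1%:R^-2 * 2^-1 ^+ k.+1.
Proof.
rewrite /Hfactor_coef add0r -[leRHS]mul1r; apply: ler_pM.
- by rewrite divr_ge0.
- exact: expm1_coef_ge0.
- by rewrite ler_pdivrMr ?ltr0n// mul1r ler_nat.
rewrite /expm1_coef exprVn -invfM lef_pV2 ?posrE.
- apply: ler_pM; rewrite ?exprn_ge0//.
    by rewrite -!natrX ler_nat leq_pexp2l.
  by rewrite -natrX ler_nat expn2_le_fact.
- by apply: mulr_gt0; rewrite ?ltr0n ?fact_gt0// exprn_gt0.
- by apply: mulr_gt0; rewrite exprn_gt0.
Qed.

Lemma sum_geom_half (R : realType) K : \sum_(k < K) 2^-1 ^+ k.+1 <= 1 :> R.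
Proof.
suff -> : \sum_(k < K) 2^-1 ^+ k.+1 = 1 - 2^-1 ^+ K :> R.
  by rewrite lerBlDr lerDl exprn_ge0.
elim: K => [|K IH]; first by rewrite big_ord0 expr0 subrr.
by rewrite big_ord_recr /= IH exprS; lra.
Qed.

(** This [1 / (n + 1)^2] is why the terms of lower excess never affect leading
    orders. *)
Lemma sum_Hfactor_coefS_le (R : realType) n K :
  \sum_(k < K) Hfactor_coef R n.+1 k.+1 <= n.+1%:R^-2.
Proof.
apply: (@le_trans _ _ (\sum_(k < K) n.+1%:R^-2 * 2^-1 ^+ k.+1)).
  by apply: ler_sum => k _; exact: Hfactor_coefS_le.
by rewrite -mulr_sumr ler_piMr ?sum_geom_half// invr_ge0 exprn_ge0.
Qed.

Lemma sum_Hfactor_coef_le (R : realType) n K :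
  \sum_(k < K) Hfactor_coef R n.+1 k <= 1 + n.+1%:R^-2.
Proof.
case: K => [|K]; first by rewrite big_ord0 addr_ge0// invr_ge0 exprn_ge0.
by rewrite big_ord_recl Hfactor_coef0 lerD2l sum_Hfactor_coefS_le.
Qed.

(** * Weighted averages over the number of parts *)

(** The divisor [n + 1] is the total weight in excess [0], so that this is a genuine
    mean for [s = 0]; for other [s] the total mass [mass n s]
    stays bounded and converges. *)
Definition wavg (R : realType) (n s : nat) (f : nat -> R) : R :=
  (\sum_(i < n.+1) f i * excess_weight R n i s) / n.+1%:R.

Definition mass (R : realType) (n s : nat) : R := wavg n s (fun=> 1).

Lemma wavg_le (R : realType) n s (f g : nat -> R) :
  (forall i, f i <= g i) -> wavg n s f <= wavg n s g.
Proof.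
move=> fg; rewrite ler_pM2r ?invr_gt0 ?ltr0n//; apply: ler_sum => i _.
by rewrite ler_wpM2r// excess_weight_ge0.
Qed.

Lemma wavgD (R : realType) n s (f g : nat -> R) :
  wavg n s (fun i => f i + g i) = wavg n s f + wavg n s g.
Proof.
rewrite /wavg -mulrDl -big_split; congr (_ / _).
by apply: eq_bigr => i _; rewrite mulrDl.
Qed.

Lemma wavgZ (R : realType) n s (a : R) (f : nat -> R) :
  wavg n s (fun i => a * f i) = a * wavg n s f.
Proof.
rewrite /wavg mulrA mulr_sumr; congr (_ / _).
by apply: eq_bigr => i _; rewrite mulrA.
Qed.

Lemma wavg_cst (R : realType) n s (a : R) : wavg n s (fun=> a) = a * mass R n s.
Proof. by rewrite -wavgZ; congr wavg; apply/funext => i; rewrite mulr1. Qed.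

Lemma wavg_ge0 (R : realType) n s (f : nat -> R) :
  (forall i, 0 <= f i) -> 0 <= wavg n s f.
Proof.
by move=> f0; have := wavg_le n s f0; rewrite wavg_cst mul0r.
Qed.

Lemma mass_ge0 (R : realType) n s : 0 <= mass R n s.
Proof. exact: wavg_ge0. Qed.

Lemma wavg_rec (R : realType) n s (f : nat -> R) :
  wavg n.+1 s f = n.+1%:R / n.+2%:R *
   (wavg n s f + \sum_(k < s.+1) expm1_coef R n.+1 k * wavg n (s - k) (f \o succn)).
Proof.
have -> : wavg n.+1 s f = (\sum_(i < n.+1) f i * excess_weight R n i s +
    \sum_(k < s.+1) expm1_coef R n.+1 k *
      \sum_(i < n.+1) f i.+1 * excess_weight R n i (s - k)) / n.+2%:R.
  congr (_ / _).
  under eq_bigr => i _ do rewrite excess_weightS mulrDr.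
  rewrite big_split; congr (_ + _).
    by rewrite big_ord_recr /= excess_weight_gt ?mulr0 ?addr0.
  rewrite big_ord_recl /= mulr0 add0r.
  under [RHS]eq_bigr => k _ do rewrite mulr_sumr.
  rewrite exchange_big; apply: eq_bigr => i _ /=; rewrite mulr_sumr.
  by apply: eq_bigr => k _; rewrite mulrCA.
rewrite mulrAC; congr (_ / _); rewrite mulrDr [in RHS]/wavg.
have n0 : n.+1%:R != 0 :> R by rewrite pnatr_eq0.
rewrite [n.+1%:R * (_ / _)]mulrC divfK//; congr (_ + _).
rewrite mulr_sumr; apply: eq_bigr => k _.
by rewrite mulrCA; congr (_ * _); rewrite /wavg mulrC divfK.
Qed.

(** A new variable is left out (weight [1]), used with exponent one (weight
    [1 / (n + 1)], excess unchanged, one more part), or used with a larger exponent,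
    which consumes some of the excess.  After normalisation the first two cases
    form a Bernoulli step of parameter [1 / (n + 2)]. *)
Lemma wavg_rec_shift (R : realType) n s (f : nat -> R) :
  wavg n.+1 s f = n.+1%:R / n.+2%:R * wavg n s f +
   n.+2%:R^-1 * wavg n s (f \o succn) +
   \sum_(k < s) Hfactor_coef R n.+1 k.+1 * wavg n (s - k.+1) (f \o succn).
Proof.
rewrite wavg_rec mulrDr big_ord_recl mulrDr addrA subn0; congr (_ + _ + _).
  have -> : expm1_coef R n.+1 (@ord0 s) = n.+1%:R^-1 by rewrite /expm1_coef expr1 mulr1.
  by rewrite mulrA; congr (_ * _); rewrite mulrAC divff ?mul1r// pnatr_eq0.
rewrite mulr_sumr; apply: eq_bigr => k _.
by rewrite mulrA /Hfactor_coef add0r.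
Qed.

Lemma mass_rec (R : realType) n s :
  mass R n.+1 s = mass R n s + \sum_(k < s) Hfactor_coef R n.+1 k.+1 * mass R n (s - k.+1).
Proof.
rewrite /mass wavg_rec_shift -mulrDl; congr (_ + _).
by rewrite -[X in _ + X]mul1r -mulrDl addrC nat1r divff ?mul1r// pnatr_eq0.
Qed.

(** The Cauchy product of the [n]-th partial product of [H] with its next
    factor. *)
Lemma mass_conv (R : realType) n s :
  mass R n.+1 s = \sum_(k < s.+1) Hfactor_coef R n.+1 k * mass R n (s - k).
Proof. by rewrite mass_rec big_ord_recl Hfactor_coef0 mul1r subn0. Qed.

Lemma mass0n (R : realType) s : mass R 0 s = (s == 0)%:R.
Proof. by rewrite /mass /wavg big_ord1 mul1r divr1. Qed.

(** A closed form that starts at [1], stays below [5], and grows at each step by at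
    least the factor [1 + 1 / (n + 1)^2] by which the coefficients can grow.  It thus
    replaces the infinite product of these factors. *)
Definition mass_majorant (R : realType) (n : nat) : R :=
  5%:R * (n.*2.+1)%:R / (n.*2 + 5)%:R.

Lemma mass_majorant0 (R : realType) : mass_majorant R 0 = 1.
Proof. by rewrite /mass_majorant mulr1 divff// pnatr_eq0. Qed.

Lemma mass_majorant_ge0 (R : realType) n : 0 <= mass_majorant R n.
Proof. by rewrite !mulr_ge0// invr_ge0. Qed.

Lemma mass_majorant_le5 (R : realType) n : mass_majorant R n <= 5.
Proof.
rewrite /mass_majorant ler_pdivrMr ?ltr0n ?addnS// ler_pM2l// ler_nat; lia.
Qed.

Lemma mass_majorantS (R : realType) n :
  mass_majorant R n * (1 + n.+1%:R^-2) <= mass_majorant R n.+1.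
Proof.
rewrite /mass_majorant.
have -> : (n.*2.+1)%:R = 2 * n%:R + 1 :> R by rewrite -mul2n -natr1 natrM.
have -> : (n.*2 + 5)%:R = 2 * n%:R + 5 :> R by rewrite -mul2n natrD natrM.
have -> : (n.+1.*2.+1)%:R = 2 * n%:R + 3 :> R.
  by rewrite -mul2n -natr1 natrM -natr1; ring.
have -> : (n.+1.*2 + 5)%:R = 2 * n%:R + 7 :> R.
  by rewrite -mul2n natrD natrM -natr1; ring.
rewrite -[n.+1%:R]natr1.
have : 0 <= n%:R :> R by [].
move: (n%:R : R) => x x0.
rewrite -subr_ge0.
(* The gap is manifestly nonnegative. *)
have -> : 5 * (2 * x + 3) / (2 * x + 7)
    - 5 * (2 * x + 1) / (2 * x + 5) * (1 + (x + 1) ^- 2)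
  = 5 * (4 * x ^+ 2 + 1) / ((2 * x + 7) * (2 * x + 5) * (x + 1) ^+ 2).
  field; repeat split; lra.
rewrite divr_ge0//; first by rewrite mulr_ge0// addr_ge0// mulr_ge0// exprn_ge0.
by rewrite !mulr_ge0// ?exprn_ge0//; lra.
Qed.

Lemma mass_le_majorant (R : realType) n s : mass R n s <= mass_majorant R n.
Proof.
elim: n s => [|n IH] s; first by rewrite mass0n mass_majorant0; case: (s == 0).
rewrite mass_conv; apply: le_trans (mass_majorantS R n).
apply: (@le_trans _ _ (\sum_(k < s.+1) mass_majorant R n * Hfactor_coef R n.+1 k)).
  by apply: ler_sum => k _; rewrite [leRHS]mulrC ler_wpM2l// Hfactor_coef_ge0.
by rewrite -mulr_sumr ler_wpM2l ?mass_majorant_ge0// sum_Hfactor_coef_le.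
Qed.

Lemma mass_le5 (R : realType) n s : mass R n s <= 5.
Proof. exact: le_trans (mass_le_majorant R n s) (mass_majorant_le5 R n). Qed.

Lemma mass_nondecreasing (R : realType) s :
  nondecreasing_seq (fun n => mass R n s).
Proof.
apply/nondecreasing_seqP => n; rewrite mass_rec lerDl; apply: sumr_ge0 => k _.
by rewrite mulr_ge0// ?Hfactor_coef_ge0 ?mass_ge0.
Qed.

Definition mass_lim (R : realType) (s : nat) : R :=
  limn (fun n => mass R n s).

Lemma mass_cvg (R : realType) s :
  (fun n => mass R n s) @ \oo --> mass_lim R s.
Proof.
apply: nondecreasing_is_cvgn; first exact: mass_nondecreasing.
by exists 5 => _ [n _ <-]; exact: mass_le5.
Qed.

Lemma mass_lim_bound (R : realType) s : `|mass_lim R s| <= 5.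
Proof.
have c := @mass_cvg R s.
have cP := cvgP _ c.
rewrite ger0_norm.
  by apply: limr_le => //; near=> n; exact: mass_le5.
by apply: limr_ge => //; near=> n; exact: mass_ge0.
Unshelve. all: by end_near. Qed.

(** * Concentration of the number of parts around log n *)

(** The sum of the parameters [1 / (m + 2)] of the Bernoulli steps: the expected
    number of parts for excess [0]. *)
Definition hsum (R : realType) (n : nat) : R := \sum_(m < n) m.+2%:R^-1.

Definition wvar (R : realType) (n s : nat) : R :=
  wavg n s (fun i => (i%:R - hsum R n) ^+ 2).

Lemma hsumS (R : realType) n : hsum R n.+1 = hsum R n + n.+2%:R^-1.
Proof. by rewrite /hsum big_ord_recr. Qed.

Lemma hsum_ge0 (R : realType) n : 0 <= hsum R n.
Proof. by apply: sumr_ge0 => m _; rewrite invr_ge0. Qed.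

Lemma hsum_le (R : realType) n : hsum R n <= n%:R.
Proof.
elim: n => [|n IH]; first by rewrite /hsum big_ord0.
by rewrite hsumS -[n.+1%:R]natr1 lerD// invf_le1 ?ltr0n// ler1n.
Qed.

(** The Bernoulli step has mean [1 / (n + 2)], by which the centre [hsum] moves, so
    the cross term vanishes and only the variance of the step is added. *)
Lemma wvar_rec (R : realType) n s :
  wvar R n.+1 s = wvar R n s
    + n.+2%:R^-1 * (1 - n.+2%:R^-1) * mass R n s
    + \sum_(k < s) Hfactor_coef R n.+1 k.+1 *
        wavg n (s - k.+1) (fun i => (i.+1%:R - hsum R n.+1) ^+ 2).
Proof.
rewrite /wvar wavg_rec_shift; congr (_ + _).
rewrite -wavg_cst -!wavgZ -!wavgD; congr wavg; apply/funext => i /=.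
have -> : n.+1%:R / n.+2%:R = 1 - n.+2%:R^-1 :> R.
  have : n.+2%:R != 0 :> R by rewrite pnatr_eq0.
  by rewrite -[n.+2%:R]natr1; move: (n.+1%:R) => x x0; field.
by rewrite hsumS -[i.+1%:R]natr1; ring.
Qed.

(** One more part and the move of the centre together shift [i - hsum R n] by
    at most one. *)
Lemma shifted_wavg_le (R : realType) n s :
  wavg n s (fun i => (i.+1%:R - hsum R n.+1) ^+ 2) <= 2 * wvar R n s + 10.
Proof.
apply: (@le_trans _ _ (2 * wvar R n s + 2 * mass R n s)); last first.
  by rewrite lerD2l; have := mass_le5 R n s; lra.
rewrite -wavg_cst -wavgZ -wavgD; apply: wavg_le => i.
rewrite hsumS -[i.+1%:R]natr1.
have d0 : 0 <= n.+2%:R^-1 :> R by rewrite invr_ge0.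
have d1 : n.+2%:R^-1 <= 1 :> R by rewrite invf_le1 ?ltr0n// ler1n.
move: (n.+2%:R^-1) d0 d1 => d d0 d1.
set x := i%:R; set h := hsum R n.
have := sqr_ge0 (x - h - (1 - d)); nra.
Qed.

(** By induction on the excess: the recursion adds at each step a variance of order
    [1 / (n + 2)], plus second moments of lower excess, of order [1 + hsum R n],
    times [1 / (n + 1)^2].  As [1 + hsum R n <= n + 1], the latter are of order
    [1 / (n + 2)] as well, and these increments sum to [O(hsum R n)]. *)
Lemma wvar_bound (R : realType) s :
  exists2 K : R, 0 <= K & forall n s', (s' <= s)%N -> wvar R n s' <= K * (1 + hsum R n).
Proof.
have step (K : R) s' : 0 <= K ->
    (forall n t, (t < s')%N -> wvar R n t <= K * (1 + hsum R n)) ->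
    forall n, wvar R n s' <= (4 * K + 25) * (1 + hsum R n).
  move=> K0 IH n.
  (* The bound without the constant term is the one that telescopes. *)
  suff : wvar R n s' <= (4 * K + 25) * hsum R n by nra.
  elim: n => [|n IHn].
    by rewrite /wvar /wavg big_ord1 /hsum big_ord0 subr0 expr0n !mul0r mulr0.
  rewrite wvar_rec [in leRHS]hsumS [leRHS]mulrDr -[leLHS]addrA lerD//.
  have sumb : \sum_(k < s') Hfactor_coef R n.+1 k.+1 *
      wavg n (s' - k.+1) (fun i => (i.+1%:R - hsum R n.+1) ^+ 2) <=
      (2 * K + 10) * (1 + hsum R n) * n.+1%:R^-2.
    apply: (@le_trans _ _ ((2 * K + 10) * (1 + hsum R n) *
      \sum_(k < s') Hfactor_coef R n.+1 k.+1)).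
      rewrite mulr_sumr; apply: ler_sum => k _; rewrite [leRHS]mulrC.
      rewrite ler_wpM2l ?Hfactor_coef_ge0//; apply: le_trans (shifted_wavg_le R _ _) _.
      have lt : (s' - k.+1 < s')%N by have := ltn_ord k; lia.
      have := IH n _ lt; have := hsum_ge0 R n; nra.
    rewrite ler_wpM2l ?sum_Hfactor_coefS_le//.
    by rewrite mulr_ge0// addr_ge0 ?hsum_ge0// mulr_ge0.
  have hn : 1 + hsum R n <= n.+1%:R by rewrite -nat1r lerD2l hsum_le.
  have M5 := mass_le5 R n s'; have M0 := mass_ge0 R n s'.
  (* The number 2 bounds the quotient of n + 2 by n + 1. *)
  have hn2 : (1 + hsum R n) * n.+1%:R^-2 <= 2 * n.+2%:R^-1.
    have n0 : 0 < n.+1%:R :> R by rewrite ltr0n.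
    apply: (@le_trans _ _ (n.+1%:R * n.+1%:R^-2)).
      by rewrite ler_wpM2r// invr_ge0 exprn_ge0.
    rewrite expr2 invfM mulrA divff ?gt_eqF// mul1r.
    rewrite ler_pdivlMr ?ltr0n// mulrC ler_pdivrMr// -[n.+2%:R]natr1.
    have : 1 <= n.+1%:R :> R by rewrite ler1n.
    lra.
  have d0 : 0 <= n.+2%:R^-1 :> R by rewrite invr_ge0.
  have d1 : n.+2%:R^-1 <= 1 :> R by rewrite invf_le1 ?ltr0n// ler1n.
  move: hn2 sumb; rewrite -mulrA.
  move: ((1 + hsum R n) * n.+1%:R^-2) (n.+2%:R^-1) d0 d1 => a d d0 d1 ad sumb.
  have : d * (1 - d) * mass R n s' <= 5 * d by nra.
  have : (2 * K + 10) * a <= (2 * K + 10) * (2 * d)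
    by rewrite ler_wpM2l// addr_ge0// mulr_ge0.
  lra.
elim: s => [|s [K K0 IH]].
  exists 25 => // n s'; rewrite leqn0 => /eqP ->.
  by have := @step 0 0%N (lexx _); rewrite mulr0 add0r; apply.
exists (4 * K + 25) => [|n s']; first by rewrite addr_ge0// mulr_ge0.
rewrite leq_eqVlt => /predU1P[->|s's]; first exact: step.
apply: le_trans (IH n s' s's) _; have := hsum_ge0 R n; nra.
Qed.

(** * Averaging the logarithm *)

Lemma ln_succ_bounds (R : realType) (x : R) : 0 < x ->
  (x + 1)^-1 <= ln (x + 1) - ln x <= x^-1.
Proof.
move=> x0; have x10 : 0 < x + 1 by lra.
apply/andP; split.
  rewrite -lerN2 opprB -ln_div ?posrE//.
  have -> : x / (x + 1) = 1 + - (x + 1)^-1 by field; lra.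
  by apply: le_ln1Dx; rewrite ltrN2 invf_lt1//; lra.
rewrite -ln_div ?posrE//.
have -> : (x + 1) / x = 1 + x^-1 by field; lra.
by apply: le_ln1Dx; apply: lt_trans (_ : 0 < _); rewrite ?invr_gt0//; lra.
Qed.

Lemma hsum_ln (R : realType) n : (0 < n)%N -> `|hsum R n - ln n%:R| <= 1.
Proof.
move=> n0.
have lnS m : m.+2%:R^-1 <= ln m.+2%:R - ln m.+1%:R :> R /\
    ln m.+2%:R - ln m.+1%:R <= m.+1%:R^-1 :> R.
  by apply/andP; rewrite -[m.+2%:R]natr1 ln_succ_bounds.
(* With n + 2 on the left, the increments of both bounds compare with 1 / (n + 2). *)
have [lo hi] : ln n.+2%:R - 1 <= hsum R n /\ hsum R n <= ln n.+1%:R.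
  elim: n {n0} => [|n [IHl IHh]]; last first.
    rewrite hsumS; case: (lnS n) (lnS n.+1) => [+ _] [_ +].
    move: IHl IHh; move: (n.+2%:R^-1) (ln n.+3%:R) (ln n.+2%:R) (ln n.+1%:R) (hsum R n).
    by move=> d a b c h ? ? ? ?; split; lra.
  by rewrite /hsum big_ord0 ln1; have := lnS 0%N;
    rewrite invr1 ln1 => -[_ ?]; split; lra.
have nle : ln n%:R <= ln n.+2%:R :> R by rewrite ler_ln ?posrE ?ltr0n// ler_nat; lia.
have nup : ln n.+1%:R <= ln n%:R + 1 :> R.
  case: n n0 {lo hi nle} => // n _; have [_ lnn] := lnS n.
  by rewrite -lerBlDl (le_trans lnn)// invf_le1 ?ltr0n// ler1n.
move: nle nup lo hi; move: (ln n.+2%:R) (ln n.+1%:R) (ln n%:R) (hsum R n).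
by move=> a b c h ? ? ? ?; rewrite ler_norml; lra.
Qed.

(** For [L <= 2 t] this is the bound [ln y <= y - 1] applied to [t / L] or [L / t];
    otherwise [|t - L| / L] is at least one half, and the left-hand side is at most
    [ln L] because [ln t >= 0]. *)
Lemma ln_dist_le (R : realType) (t L : R) : 1 <= t -> 0 < L -> 1 <= ln L ->
  `|ln t - ln L| <= ln L * (2 * (`|t - L| / L)).
Proof.
move=> t1 L0 lnL1; have t0 : 0 < t by lra.
have ln_dist_aux (a b : R) : 0 < a -> 0 < b -> ln a - ln b <= (a - b) / b.
  move=> a0 b0; rewrite -ln_div ?posrE//.
  have -> : a / b = 1 + (a - b) / b by field; lra.
  by apply: le_ln1Dx; rewrite ltr_pdivlMr//; lra.
have d0 : 0 <= `|t - L| / L by rewrite divr_ge0// ltW.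
have [tL|tL] := leP L t.
  rewrite ger0_norm ?subr_ge0 ?ler_ln ?posrE//.
  apply: le_trans (ln_dist_aux _ _ t0 L0) _.
  have : (t - L) / L <= `|t - L| / L by rewrite ler_pM2r ?invr_gt0// ler_norm.
  nra.
rewrite distrC ger0_norm; last by rewrite subr_ge0 ler_ln ?posrE// ltW.
have [tL2|tL2] := leP L (2 * t).
  apply: le_trans (ln_dist_aux _ _ L0 t0) _.
  have : (L - t) / t <= 2 * (`|t - L| / L).
    rewrite distrC ger0_norm; last by rewrite subr_ge0 ltW.
    rewrite mulrCA ler_wpM2l//; first by rewrite subr_ge0 ltW.
    by rewrite ler_pdivlMr// mulrC ler_pdivrMr.
  nra.
have : 1 <= 2 * (`|t - L| / L).
  rewrite distrC ger0_norm; last by rewrite subr_ge0 ltW.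
  by rewrite mulrA ler_pdivlMr//; lra.
have := ln_ge0 t1; nra.
Qed.

(** The inequality [y <= e + y ^ 2 / e] trades the distance for its square, whose
    average is known, at the cost of an arbitrarily small constant. *)
Lemma ln_dist_le_sq (R : realType) (t L e : R) :
  1 <= t -> 0 < L -> 1 <= ln L -> 0 < e ->
  `|ln t - ln L| <= ln L * (2 * e + 2 * (t - L) ^+ 2 / (e * L ^+ 2)).
Proof.
move=> t1 L0 lnL1 e0; apply: le_trans (ln_dist_le t1 L0 lnL1) _.
rewrite ler_wpM2l//; first lra.
have -> : 2 * (t - L) ^+ 2 / (e * L ^+ 2) = 2 * ((`|t - L| / L) ^+ 2 / e).
  by rewrite -(real_normK (num_real (t - L))); field; lra.
rewrite -mulrDr ler_pM2l//.
move: (`|t - L| / L) => y.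
have : e * (e + y ^+ 2 / e - y) >= 0.
  have -> : e * (e + y ^+ 2 / e - y) = (y - e / 2) ^+ 2 + 3 / 4 * e ^+ 2 by field; lra.
  by rewrite addr_ge0 ?sqr_ge0// mulr_ge0 ?sqr_ge0.
by rewrite pmulr_rge0// subr_ge0.
Qed.

(** Moving the centre from [hsum R n] to [ln n - r] costs a bounded amount, since
    these differ by at most [r + 1]. *)
Lemma wavg_sq_dist_ln (R : realType) (s r : nat) :
  exists2 K : R, 0 <= K & forall n, (0 < n)%N -> 1 <= ln (n%:R : R) ->
    wavg n s (fun i => ((i + r)%:R - ln n%:R) ^+ 2) <= K * ln n%:R.
Proof.
have [K K0 VK] := wvar_bound R s.
exists (6 * K + 10 * (r%:R + 1) ^+ 2) => [|n n0].
  by rewrite addr_ge0// mulr_ge0// sqr_ge0.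
set L := ln n%:R => L1.
apply: (@le_trans _ _ (2 * wvar R n s + 2 * (r%:R + 1) ^+ 2 * mass R n s)).
  rewrite -wavg_cst -wavgZ -wavgD; apply: wavg_le => i; rewrite natrD.
  have := hsum_ln R n0; rewrite -/L ler_norml => /andP[].
  have : 0 <= r%:R :> R by [].
  move: (hsum R n) (r%:R) (i%:R) => h ρ x ρ0 h1 h2.
  have : (ρ + h - L) ^+ 2 <= (ρ + 1) ^+ 2 by nra.
  have := sqr_ge0 ((x - h) - (ρ + h - L)); nra.
have V := VK n s (leqnn s); have M := mass_le5 R n s.
have := hsum_ln R n0; rewrite -/L ler_norml => /andP[_ hL].
have A : 2 * (r%:R + 1) ^+ 2 * mass R n s <= 10 * (r%:R + 1) ^+ 2 * L.
  have := sqr_ge0 (r%:R + 1 : R); move: ((r%:R + 1 : R) ^+ 2) => q q0; nra.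
have : K * (1 + hsum R n) <= 3 * K * L by nra.
nra.
Qed.

Lemma near_ln_nat_ge (R : realType) (A : R) : \forall n \near \oo, A <= ln (n%:R : R).
Proof.
near=> n.
have nA : expR A <= n%:R by near: n; exact: nbhs_infty_ger.
rewrite -[A]expRK ler_ln ?posrE ?expR_gt0//.
exact: lt_le_trans (expR_gt0 A) nA.
Unshelve. all: by end_near. Qed.

(** The pointwise bound [ln_dist_le_sq] averages to [ln (ln n)] times
    [O(e + 1 / (e * ln n))], and the second factor is small once [ln n] is
    large compared with [1 / e ^ 2]. *)
Lemma wavg_ln_cvg (R : realType) (s r : nat) : (0 < r)%N ->
  (fun n => wavg n s (fun i => ln (i + r)%:R) / ln (ln n%:R) - mass R n s) @ \oo
    --> (0 : R).
Proof.
move=> r0; have [K K0 VK] := wavg_sq_dist_ln R s r.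
apply/cvgr0Pnorm_le => e' e'0.
(* The final estimate is 2 e times the mass bound 5, plus 2 e. *)
pose e := e' / 12; have e0 : 0 < e by rewrite divr_gt0.
near=> n.
have n0 : (0 < n)%N by near: n; exact: nbhs_infty_gt.
have L1 : 1 <= ln (n%:R : R) by near: n; exact: near_ln_nat_ge.
have Lexp : expR 1 <= ln (n%:R : R) by near: n; exact: near_ln_nat_ge.
have LK : K / e ^+ 2 <= ln (n%:R : R) by near: n; exact: near_ln_nat_ge.
have {VK} := VK n n0 L1.
move: (ln (n%:R : R)) L1 Lexp LK => L L1 Lexp LK VK.
have L0 : 0 < L by lra.
have lnL1 : 1 <= ln L by rewrite -[leLHS]expRK ler_ln ?posrE ?expR_gt0.
have lnL0 : 0 < ln L by lra.
have -> : wavg n s (fun i => ln (i + r)%:R) / ln L - mass R n s =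
   (wavg n s (fun i => ln (i + r)%:R + -1 * ln L)) / ln L.
  by rewrite wavgD wavgZ wavg_cst mulrDl; congr (_ + _); field; lra.
rewrite normrM normfV (gtr0_norm lnL0) ler_pdivrMr//.
pose g i : R := ln L * (2 * e + 2 / (e * L ^+ 2) * ((i + r)%:R - L) ^+ 2).
have gb i : `|ln (i + r)%:R + -1 * ln L| <= g i.
  rewrite mulN1r /g mulrAC; apply: ln_dist_le_sq => //.
  by rewrite ler1n addn_gt0 r0 orbT.
have : `|wavg n s (fun i => ln (i + r)%:R + -1 * ln L)| <= wavg n s g.
  rewrite ler_norml -[- wavg _ _ g]mulN1r -wavgZ.
  apply/andP; split; apply: wavg_le => i.
    by rewrite [-1 * g i]mulN1r; have := gb i; rewrite ler_norml => /andP[].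
  by have := gb i; rewrite ler_norml => /andP[].
move/le_trans; apply.
rewrite wavgZ wavgD wavg_cst wavgZ mulrC ler_wpM2r//; first lra.
have M5 := mass_le5 R n s.
have c0 : 0 < 2 / (e * L ^+ 2) by rewrite divr_gt0// mulr_gt0// exprn_gt0.
have : 2 / (e * L ^+ 2) * wavg n s (fun i => ((i + r)%:R - L) ^+ 2) <= 2 * e.
  apply: (@le_trans _ _ (2 / (e * L ^+ 2) * (K * L))); first by rewrite ler_pM2l.
  have -> : 2 / (e * L ^+ 2) * (K * L) = 2 * e * (K / e ^+ 2 / L) by field; lra.
  have q1 : K / e ^+ 2 / L <= 1 by rewrite ler_pdivrMr// mul1r.
  by rewrite ler_piMr//; lra.
have : 2 * e * mass R n s <= 10 * e by nra.
have -> : e' = 12 * e by rewrite /e; field.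
lra.
Unshelve. all: by end_near. Qed.

(** * Taylor coefficients of power series *)

Lemma cvg_pseries_geom_bound (R : realType) (c : R^nat) (A B x : R) :
  0 < B -> (forall i, `|c i| <= A * B ^+ i) -> `|x| < B^-1 ->
  cvgn (pseries c x).
Proof.
move=> B0 cAB xB; apply: normed_cvg.
have geomP i : `|c i * x ^+ i| <= geometric A (B * `|x|) i.
  by rewrite normrM normrX /= exprMn mulrA ler_wpM2r// exprn_ge0.
apply: (@series_le_cvg _ _ (geometric A (B * `|x|))) => [i|i|i|].
- exact: normr_ge0.
- exact: le_trans (geomP i).
- exact: geomP.
- apply: is_cvg_geometric_series; rewrite normrM normr_id gtr0_norm//.
  by rewrite mulrC -ltr_pdivlMr// mul1r.
Qed.

(** Since [i + 1 <= 2 ^ i], differentiating a power series keeps a geometric bound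
    on its coefficients if the ratio is doubled.  Losing radius this way is
    harmless: only finitely many derivatives at [0] are taken. *)
Lemma pseries_diffs_geom_bound (R : realType) (c : R^nat) (A B : R) :
  0 < B -> (forall i, `|c i| <= A * B ^+ i) ->
  forall i, `|pseries_diffs c i| <= (A * B) * (2 * B) ^+ i.
Proof.
move=> B0 cAB i; rewrite /pseries_diffs normrM normr_nat.
have A0 : 0 <= A by have := le_trans (normr_ge0 _) (cAB 0); rewrite expr0 mulr1.
apply: (@le_trans _ _ (2 ^+ i * (A * B ^+ i.+1))).
  apply: ler_pM => //; rewrite -natrX ler_nat.
  exact: ltn_expl.
by rewrite exprMn exprS le_eqVlt; apply/orP; left; apply/eqP; ring.
Qed.

(** The geometric bound on the differentiated coefficients is carried along the
    induction, because the differentiation theorem for power series asks for the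
    convergence of the first two differentiated series at a larger point. *)
Lemma derive1n_pseries (R : realType) (f : R -> R) (c : R^nat) (A B : R) (k : nat) :
  0 < B -> (forall i, `|c i| <= A * B ^+ i) ->
  (\forall x \near 0, f x = limn (pseries c x)) ->
  (exists A' B', 0 < B' /\
    forall i, `|iter k (@pseries_diffs R) c i| <= A' * B' ^+ i) /\
  \forall x \near 0, derive1n k f x = limn (pseries (iter k (@pseries_diffs R) c) x).
Proof.
move=> B0 cAB fc; elim: k => [|k [[A1 [B1 [B10 bnd]]] IH]].
  by split; [exists A, B | near do rewrite derive1n0].
set d := iter k _ c in bnd IH *.
have bnd1 := pseries_diffs_geom_bound B10 bnd.
have B20 : 0 < 2 * B1 by rewrite mulr_gt0.
have bnd2 := pseries_diffs_geom_bound B20 bnd1.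
split; first by exists (A1 * B1), (2 * B1).
(* A point at which the series and its first two derivatives converge. *)
pose K : R := (2 * (2 * (2 * B1)))^-1.
have K0 : 0 < K by rewrite invr_gt0 !mulr_gt0.
have KB1 : `|K| < B1^-1 by rewrite gtr0_norm// ltf_pV2 ?posrE ?mulr_gt0//; lra.
have KB2 : `|K| < (2 * B1)^-1 by rewrite gtr0_norm// ltf_pV2 ?posrE ?mulr_gt0//; lra.
have KB3 : `|K| < (2 * (2 * B1))^-1
  by rewrite gtr0_norm// ltf_pV2 ?posrE ?mulr_gt0//; lra.
near=> x.
rewrite derive1nS derive1E iterS -/d.
have xK : `|x| < `|K|.
  by near: x; apply: (@nbhs0_lt R R); rewrite gtr0_norm.
have := pseries_snd_diffs (cvg_pseries_geom_bound B10 bnd KB1)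
  (cvg_pseries_geom_bound B20 bnd1 KB2)
  (cvg_pseries_geom_bound (mulr_gt0 (ltr0n _ 2) B20) bnd2 KB3) xK.
move=> [_ <-]; apply: near_eq_derive.
by near: x; apply: (near_join IH).
Unshelve. all: by end_near. Qed.

Lemma pseries_at0 (R : realType) (d : R^nat) : limn (pseries d 0) = d 0%N.
Proof.
apply/cvg_lim => //; rewrite -cvg_shiftS.
apply: cvg_near_cst; near=> n.
rewrite /pseries /series /= big_nat_recl// expr0 mulr1 big1 ?addr0// => i _.
by rewrite exprS mul0r mulr0.
Unshelve. all: by end_near. Qed.

Lemma iter_pseries_diffs (R : realType) (c : R^nat) (k i : nat) :
  iter k (@pseries_diffs R) c i * i`!%:R = (i + k)`!%:R * c (i + k)%N.
Proof.
elim: k i => [|k IH] i; first by rewrite addn0 mulrC.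
rewrite iterS {1}/pseries_diffs addnS -addSn -IH factS natrM; ring.
Qed.

Lemma taylor_coef_pseries (R : realType) (f : R -> R) (c : R^nat) (A B : R) (k : nat) :
  0 < B -> (forall i, `|c i| <= A * B ^+ i) ->
  (\forall x \near 0, f x = limn (pseries c x)) ->
  taylor_coef f 0 k = c k.
Proof.
move=> B0 cAB fc; rewrite /taylor_coef.
have [_ /nbhs_singleton ->] := derive1n_pseries k B0 cAB fc.
rewrite pseries_at0.
have := iter_pseries_diffs c k 0; rewrite mulr1 add0n => ->.
by rewrite mulrC mulKf// pnatr_eq0 -lt0n fact_gt0.
Qed.

(** * The power series of the product H *)

Definition Hprod_partial (R : realType) (n : nat) (u : R) : R :=
  \prod_(1 <= q < n.+1) Hfactor q u.

(** The Taylor polynomial of [Hprod_partial R n] at [0] with [S] terms. *)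
Definition mass_poly (R : realType) (n S : nat) (u : R) : R :=
  \sum_(s < S) mass R n s * u ^+ s.

Lemma expm1_coef_cvg (R : realType) (q : nat) (u : R) : (0 < q)%N ->
  (fun K => \sum_(k < K) expm1_coef R q k * u ^+ k) @ \oo -->
  (if u == 0 then q%:R^-1 else (expR (u / q%:R) - 1) / u).
Proof.
move=> q0; case: eqP => [->|/eqP u0].
  rewrite -cvg_shiftS; apply: cvg_near_cst; near=> K.
  rewrite /= big_ord_recl expr0 mulr1 big1 ?addr0 /expm1_coef ?expr1 ?mulr1// => i _.
  by rewrite expr0n mulr0.
have -> : (fun K => \sum_(k < K) expm1_coef R q k * u ^+ k) =
    (fun K => (series (exp_coeff (u / q%:R)) K.+1 - 1) / u).
  apply/funext => K; rewrite /series /= big_nat_recl// /exp_coeff /= expr0 fact0 divr1.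
  rewrite addrAC subrr add0r big_mkord mulr_suml; apply: eq_bigr => k _.
  rewrite /expm1_coef invfM exprMn exprVn [u ^+ k.+1]exprS.
  move: (k.+1`!%:R^-1) (q%:R ^- k.+1) => a b; rewrite -!mulrA [RHS]mulrC.
  by rewrite -!mulrA mulVf// mulr1; ring.
apply: cvgMl; apply: cvgB; last exact: cvg_cst.
have : series (exp_coeff (u / q%:R)) @ \oo --> expR (u / q%:R).
  exact: is_cvg_series_exp_coeff.
by rewrite -cvg_shiftS.
Unshelve. all: by end_near. Qed.

Lemma Hfactor_cvg (R : realType) (n : nat) (u : R) :
  (fun K => \sum_(k < K) Hfactor_coef R n.+1 k * u ^+ k) @ \oo --> Hfactor n.+1 u.
Proof.
rewrite -cvg_shiftS.
have -> : [sequence \sum_(k < K.+1) Hfactor_coef R n.+1 k * u ^+ k]_K =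
   (fun K => n.+1%:R / n.+2%:R * (1 + \sum_(k < K.+1) expm1_coef R n.+1 k * u ^+ k)).
  apply/funext => K /=; rewrite big_ord_recl [X in 1 + X]big_ord_recl addrA mulrDr.
  congr (_ + _); first by rewrite /Hfactor_coef expr0 !mulr1.
  rewrite mulr_sumr; apply: eq_bigr => k _.
  by rewrite /Hfactor_coef /= add0r mulrA.
apply: cvgMr; apply: cvgD; first exact: cvg_cst.
have := @expm1_coef_cvg R n.+1 u isT; by rewrite -cvg_shiftS.
Qed.

(** Multiplying by the power series of the next factor and truncating amounts to
    truncating the previous polynomial earlier.  The index [k] may run past [S], as
    the corresponding Taylor polynomials are empty; this allows the series of the
    factor to be summed to infinity while [S] is fixed. *)
Lemma mass_poly_rec (R : realType) (n S K : nat) (u : R) : (S <= K)%N ->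
  mass_poly n.+1 S u =
  \sum_(k < K) Hfactor_coef R n.+1 k * u ^+ k * mass_poly n (S - k) u.
Proof.
elim: S => [|S IH] SK.
  by rewrite /mass_poly big_ord0 big1// => k _; rewrite sub0n big_ord0 mulr0.
rewrite /mass_poly big_ord_recr /= -/(mass_poly _ _ _) IH; last exact: ltnW.
rewrite mass_conv mulr_suml.
rewrite (big_ord_widen K (fun k => Hfactor_coef R n.+1 k * mass R n (S - k) * u ^+ S))//.
rewrite [X in _ + X]big_mkcond -big_split; apply: eq_bigr => k _ /=.
case: ifPn => [kS|]; last first.
  rewrite -leqNgt => Sk; rewrite addr0; congr (_ * _).
  have -> : (S.+1 - k = 0)%N by apply/eqP; rewrite subn_eq0.
  by have -> : (S - k = 0)%N by apply/eqP; rewrite subn_eq0 ltnW.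
rewrite subSn// /mass_poly big_ord_recr /= mulrDr; congr (_ + _).
by rewrite [RHS]mulrACA -exprD subnKC.
Qed.

(** Induction on [n].  By [mass_poly_rec] the error for [n + 1] is a series in the
    errors for [n] at precisions [S - k], each multiplied by [u^k]; every term is
    thus of order [|u|^S], and the coefficients of the factor sum to at most
    [1 + 1 / (n + 1)^2]. *)
Lemma Hprod_partial_approx (R : realType) (n S : nat) (u : R) : `|u| <= 1 ->
  `|Hprod_partial n u - mass_poly n S u| <= mass_majorant R n * `|u| ^+ S.
Proof.
move=> u1; elim: n S => [|n IH] S.
  rewrite /Hprod_partial big_geq// /mass_poly mass_majorant0 mul1r.
  case: S => [|S]; first by rewrite big_ord0 subr0 normr1.
  rewrite big_ord_recl mass0n mulr1n mul1r expr0.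
  rewrite big1 ?addr0 ?subrr ?normr0 ?exprn_ge0//.
  by move=> i _; rewrite mass0n mul0r.
have -> : Hprod_partial n.+1 u = Hfactor n.+1 u * Hprod_partial n u.
  by rewrite /Hprod_partial big_nat_recr// mulrC.
have cv : (fun K => \sum_(k < K) Hfactor_coef R n.+1 k * u ^+ k * Hprod_partial n u
   - mass_poly n.+1 S u) @ \oo -->
   Hfactor n.+1 u * Hprod_partial n u - mass_poly n.+1 S u.
  apply: cvgB; last exact: cvg_cst.
  under eq_fun => K do rewrite -mulr_suml.
  by apply: cvgMl; exact: Hfactor_cvg.
rewrite -(cvg_lim _ (cvg_norm cv))//; apply: limr_le.
  by apply/cvgP; exact: (cvg_norm cv).
near=> K.
rewrite (@mass_poly_rec _ n S K) -?sumrB; last by near: K; exact: nbhs_infty_ge.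
apply: le_trans (ler_norm_sum _ _ _) _.
apply: (@le_trans _ _ (\sum_(k < K) mass_majorant R n * `|u| ^+ S * Hfactor_coef R n.+1 k)).
  apply: ler_sum => k _; rewrite -mulrBr [in leLHS]normrM.
  rewrite [`|Hfactor_coef _ _ _ * _|]normrM [leRHS]mulrC.
  rewrite [`|Hfactor_coef _ _ _|]ger0_norm ?Hfactor_coef_ge0//.
  rewrite -[leLHS]mulrA ler_wpM2l ?Hfactor_coef_ge0//.
  apply: (@le_trans _ _ (`|u| ^+ k * (mass_majorant R n * `|u| ^+ (S - k)))).
    by rewrite normrX ler_wpM2l ?exprn_ge0.
  rewrite mulrCA ler_wpM2l ?mass_majorant_ge0// -exprD ler_wiXn2l//.
  by rewrite -leq_subLR.
rewrite -mulr_sumr mulrAC ler_wpM2r ?exprn_ge0//.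
apply: le_trans (mass_majorantS R n).
by rewrite ler_wpM2l ?mass_majorant_ge0// sum_Hfactor_coef_le.
Unshelve. all: by end_near. Qed.

Lemma mass_poly_cvg (R : realType) (S : nat) (u : R) :
  (fun n => mass_poly n S u) @ \oo --> pseries (@mass_lim R) u S.
Proof.
rewrite /pseries /series /= big_mkord /mass_poly.
apply: (cvg_big (fun x => @add_continuous R x)) => s _; apply: cvgMl; exact: mass_cvg.
Qed.

(** The uniformity in [n] of [Hprod_partial_approx] allows the limits in [S] and in [n]
    to be exchanged. *)
Lemma Hprod_partial_cvg (R : realType) (u : R) : `|u| < 1 ->
  (fun n => Hprod_partial n u) @ \oo --> limn (pseries (@mass_lim R) u).
Proof.
move=> u1.
have cvl : pseries (@mass_lim R) u @ \oo --> limn (pseries (@mass_lim R) u).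
  apply: (@cvg_pseries_geom_bound _ _ 5 1); rewrite ?invr1// => i.
  by rewrite expr1n mulr1 mass_lim_bound.
have geo0 : geometric 5 `|u| @ \oo --> (0 : R).
  by apply: cvg_geometric; rewrite normr_id.
apply/cvgrPdist_le => e e0.
have e30 : 0 < e / 3 by rewrite divr_gt0.
have [S [tailS geoS]] : exists S,
    `|limn (pseries (@mass_lim R) u) - pseries (@mass_lim R) u S| <= e / 3 /\
    `|0 - geometric 5 `|u| S| <= e / 3.
  have [S] := @filter_ex _ \oo _ _
    (filterI (cvgr_dist_le _ _ cvl _ e30) (cvgr_dist_le _ _ geo0 _ e30)).
  by case=> ? ?; exists S.
near=> n.
have polyS : `|pseries (@mass_lim R) u S - mass_poly n S u| <= e / 3.
  by near: n; apply: (cvgr_dist_le _ _ (@mass_poly_cvg R S u) _ e30).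
have Hn : `|Hprod_partial n u - mass_poly n S u| <= e / 3.
  apply: le_trans (Hprod_partial_approx n S (ltW u1)) _.
  apply: le_trans geoS; rewrite sub0r normrN [leRHS]ger0_norm /=.
    by rewrite ler_wpM2r ?exprn_ge0// mass_majorant_le5.
  by rewrite mulr_ge0// exprn_ge0.
rewrite [leRHS](_ : e = e / 3 + e / 3 + e / 3); last by field.
rewrite distrC in Hn.
apply: le_trans (ler_distD (mass_poly n S u) _ _) _; rewrite lerD//.
by apply: le_trans (ler_distD (pseries (@mass_lim R) u S) _ _) _; rewrite lerD.
Unshelve. all: by end_near. Qed.

Lemma Ccoef_mass_lim (R : realType) (s : nat) : Ccoef R s.+1 = mass_lim R s.
Proof.
rewrite /Ccoef subSS subn0; apply: (@taylor_coef_pseries _ _ _ 5 1) => //.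
  by move=> i; rewrite expr1n mulr1 mass_lim_bound.
near=> u; apply/cvg_lim => //; apply: Hprod_partial_cvg.
by near: u; exact: (@nbhs0_lt R R).
Unshelve. all: by end_near. Qed.

(** * The asymptotics of the sum *)

(** The index [i = 0] may be added to the sum: its weight vanishes unless the excess
    is [0], and in that case the logarithm is [ln 1 = 0]. *)
Lemma Asum_wavg (R : realType) (s n : nat) :
  Asum R s.+1 n = n.+1%:R * wavg n s (fun i => ln (i + s.+1)%:R).
Proof.
rewrite /wavg mulrC divfK ?pnatr_eq0//.
rewrite -(big_mkord xpredT (fun i => ln (i + s.+1)%:R * excess_weight R n i s)).
rewrite big_nat_recl// add0n.
have -> : ln s.+1%:R * excess_weight R n 0 s = 0.
  case: s => [|s]; first by rewrite ln1 mul0r.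
  suff -> : excess_weight R n 0 s.+1 = 0 by rewrite mulr0.
  by elim: n => [|n IH] //=; rewrite IH addr0.
rewrite add0r /Asum big_add1 /=; apply: eq_bigr => i _.
by rewrite -Ecoef_excess_weight addnS subSS subn0.
Qed.

Theorem theorem3p5 (R : realType) (r : nat) (hr : (1 <= r)%N) :
  (fun n : nat => Asum R r n / (n%:R * ln (ln n%:R))) @ \oo --> Ccoef R r.
Proof.
case: r hr => // s _; rewrite Ccoef_mass_lim.
have ratio : (fun n => 1 + n%:R^-1 : R) @ \oo --> (1 : R).
  rewrite -[X in _ --> X]addr0; apply: cvgD; first exact: cvg_cst.
  have := @cvg_harmonic R; rewrite /harmonic -(@cvg_shiftS R (fun n => n%:R^-1)); exact.
have := cvgM ratio (cvgD (@wavg_ln_cvg R s s.+1 isT) (@mass_cvg R s)).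
rewrite mul1r add0r; move=> cv; apply: (cvg_trans _ (cv _ _)).
apply: near_eq_cvg; near=> n.
have n0 : n%:R != 0 :> R.
  by rewrite pnatr_eq0 -lt0n; near: n; exact: nbhs_infty_gt.
rewrite /= fctE subrK Asum_wavg invfM -[n.+1%:R]natr1.
move: (ln (ln n%:R))^-1 (wavg _ _ _) => a b; by field.
Unshelve. all: by end_near. Qed.
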